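(* Let $\mathfrak p$ be an unordered hypergraph property, and let $m\ge 0$, $n\ge 1$ be integers. Then $$\alpha^\ast_{\mathfrak p}(m,n)=\sum_{(\alpha_1,\dots,\alpha_n)}\ \sum_{\pi\in\Pi(\alpha_1,\dots,\alpha_n)}\alpha_{\mathfrak p}(m,n;\pi)\left[\prod_{i=1}^n\bigl[(-1)^{i-1}(i-1)!\bigr]^{\alpha_i}\right],$$ where the outer sum is over all $n$-tuples $(\alpha_1,\dots,\alpha_n)$ of non-negative integers with $\alpha_1+2\alpha_2+\dots+n\alpha_n=n$.
   Context: An unordered (labelled) $(m,n)$-hypergraph $H$ consists of a linearly ordered vertex set $V=\{V[1]<\dots<V[n]\}$ with $n\ge1$ elements together with an unordered finite family of $m$ subsets of $V$, called edges; edges may be empty and may repeat, so the family is a multiset of $m$ subsets of $V$. Two such hypergraphs are identified if the order-preserving bijection of their vertex sets carries one family of edges to the other (with multiplicities), so one counts $(m,n)$-hypergraphs on a fixed linearly ordered $n$-set. An unordered hypergraph property is a property of such hypergraphs, invariant under this identification. For vertices $u,v$ of $H$ write $u\sim_H v$ if every edge of $H$ contains either both or neither of $u,v$. $H$ is a $T_0$-hypergraph if $u\not\sim_H v$ for all distinct vertices $u,v$. $\alpha^\ast_{\mathfrak p}(m,n)$ is the number of $(m,n)$-hypergraphs that have property $\mathfrak p$ and are $T_0$-hypergraphs. For a partition $\pi$ of $\{1,\dots,n\}$, $\alpha_{\mathfrak p}(m,n;\pi)$ is the number of $(m,n)$-hypergraphs $H$ with property $\mathfrak p$ such that $V[i]\sim_H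 V[j]$ whenever $i,j$ lie in the same class of $\pi$. $\Pi(\alpha_1,\dots,\alpha_n)$ is the set of all partitions of $\{1,\dots,n\}$ having exactly $\alpha_i$ classes of cardinality $i$ for every $i\in\{1,\dots,n\}$. *)

(* Defs.v *)
From HB Require Import structures.
From mathcomp Require Import all_boot all_order all_algebra.

Set Implicit Arguments.
Unset Strict Implicit.
Unset Printing Implicit Defensive.

(* The vertex set is the ordered set 'I_n, with V[i] being the vertex i - 1.
   The family of edges is a multiset of m subsets of 'I_n, given by its
   multiplicity function. A multiplicity never exceeds m, so taking it in
   'I_m.+1 excludes nothing and makes the type of hypergraphs finite. *)
Record hypergraph (m n : nat) := Hypergraph {
  edge_mult :> {ffun {set 'I_n} -> 'I_m.+1};
  _ : \sum_(e : {set 'I_n}) edge_mult e == m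
}.

HB.instance Definition _ m n := [isSub for @edge_mult m n].
HB.instance Definition _ m n := [Finite of hypergraph m n by <:].

(* An order-preserving bijection between finite linearly ordered sets is
   unique, so every hypergraph is identified with exactly one on 'I_n, and an
   invariant property is an arbitrary predicate on these representatives. *)
Definition hypergraph_property := forall m n : nat, pred (hypergraph m n).

Section Hypergraph.

Variables (m n : nat) (H : hypergraph m n).

Definition is_edge (e : {set 'I_n}) : bool := 0 < H e.

Definition vertex_equiv (u v : 'I_n) : bool :=
  [forall (e | is_edge e), (u \in e) == (v \in e)].

Definition T0_hypergraph : bool :=
  [forall u, forall v, (u != v) ==> ~~ vertex_equiv u v].

Definition compatible (P : {set {set 'I_n}}) : bool :=
  [forall B in P, forall i in B, forall j in B, vertex_equiv i j].

End Hypergraph.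

Definition alpha_star (p : hypergraph_property) (m n : nat) : nat :=
  #|[set H : hypergraph m n | p m n H & T0_hypergraph H]|.

Definition alpha_part (p : hypergraph_property) (m n : nat)
    (P : {set {set 'I_n}}) : nat :=
  #|[set H : hypergraph m n | p m n H & compatible H P]|.

(* Ordinals start at 0: a i stands for alpha_(i + 1), the number of classes of
   cardinality i + 1. *)
Definition partitions_of_type (n : nat) (a : 'I_n -> nat) :
    {set {set {set 'I_n}}} :=
  [set P | partition P [set: 'I_n] &
     [forall i : 'I_n, #|[set B in P | #|B| == i.+1]| == a i]].

(* The solutions of alpha_1 + 2 alpha_2 + ... + n alpha_n = n; the equation
   forces each alpha_i <= n, so entries in 'I_n.+1 cover all of them. *)
Definition partition_types (n : nat) : {set n.-tuple 'I_n.+1} :=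
  [set a : n.-tuple 'I_n.+1 | \sum_(i < n) i.+1 * tnth a i == n].

(* Main.v *)
Require Import Defs.
From mathcomp Require Import all_boot all_order all_algebra.

(** Exchanging the sums, a hypergraph [H] with the property contributes the sum
    of [prod_B (-1)^(|B|-1) (|B|-1)!] over the partitions whose blocks [B] lie
    in classes of [~_H]. This sum is 1 if [~_H] is equality and 0 otherwise, by
    induction on the ground set. Splitting off the block [B] of a point [x]
    whose class [C] has [c > 1] elements leaves a sum that can be nonzero only
    if [B = C] or [B = C \ {y}] with [y <> x], so that the total is, up to sign,
    [(c-1)! - (c-1) (c-2)! = 0]. *)

Set Implicit Arguments.
Unset Strict Implicit.
Unset Printing Implicit Defensive.

Import GRing.Theory.

Local Open Scope ring_scope.

(** Partitions are sorted by the block [B] containing [x]. Removing [B] gives a bijection onto the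
    partitions of [S :\: B], with inverse [Q |-> B |: Q]. *)
Lemma sum_partition_pblock (R : comPzSemiRingType) (T : finType)
    (w : {set T} -> R) (S : {set T}) (x : T) : x \in S ->
  \sum_(P | partition P S) \prod_(B in P) w B =
  \sum_(B : {set T} | (x \in B) && (B \subset S))
    w B * \sum_(Q | partition Q (S :\: B)) \prod_(C in Q) w C.
Proof.
move=> xS.
rewrite (partition_big (fun P => pblock P x)
  (fun B : {set T} => (x \in B) && (B \subset S))) /=; last first.
  move=> P partP; have covP := cover_partition partP.
  rewrite mem_pblock covP xS -covP /=.
  by apply: (bigcup_max (pblock P x)) => //; rewrite pblock_mem ?covP.
apply: eq_bigr => B /andP[xB BS].
rewrite (reindex_onto (fun Q => B |: Q) (fun P => P :\ B)); last first.
  move=> P /andP[partP /eqP <-]; apply: setD1K.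
  by rewrite pblock_mem // (cover_partition partP).
have B0 : B != set0 by apply/set0Pn; exists x.
rewrite big_distrr /=; apply: eq_big => [Q | Q /andP[_ /eqP BQ]]; last first.
  by rewrite big_setU1 // -BQ setD11.
apply/idP/idP => [/andP[/andP[partBQ _] /eqP <-] | partQ].
  by apply: partitionD1; rewrite ?setU11.
have dis : [disjoint B & S :\: B].
  by rewrite disjoint_sym disjoints_subset setDE subsetIr.
have partBQ : partition (B |: Q) S.
  by rewrite -(setID S B) (setIidPr BS); apply: partitionU1.
have [_ trivBQ _] := and3P partBQ.
rewrite partBQ (def_pblock trivBQ (setU11 _ _) xB) eqxx /= setU1K //.
(* What remains is [B \notin Q]: the members of [Q] lie in [S :\: B], which misses [x]. *)
apply: contraL xB => BQ.
have : B \subset cover Q by apply: (bigcup_max B).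
rewrite (cover_partition partQ) => /subsetP BSB.
by apply/negP => xB; have := BSB x xB; rewrite inE xB.
Qed.

(** The Möbius function of the partition lattice of [B], from the finest to the coarsest
    partition. *)
Definition block_weight (T : finType) (B : {set T}) : int :=
  (-1) ^+ #|B|.-1 * (#|B|.-1`!)%:Z.

Definition constant_on (T : finType) (U : eqType) (f : T -> U) (B : {set T}) :=
  [forall i in B, forall j in B, f i == f j].

Lemma constant_onP (T : finType) (U : eqType) (f : T -> U) (B : {set T}) :
  reflect {in B &, forall i j, f i = f j} (constant_on f B).
Proof.
apply: (iffP 'forall_in_forall_inP) => [eqf i j iB jB | eqf i iB].
  by apply/eqP; apply: eqf.
by move=> j jB; apply/eqP; apply: eqf.
Qed.

(** The fibres of [f] stand for the classes of an equivalence relation. The set [S] is arbitrary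
    because the induction on its size passes to [S :\: B]. *)
Lemma sum_partition_constant_on (T : finType) (U : eqType) (f : T -> U)
    (S : {set T}) :
  \sum_(P | partition P S)
     \prod_(B in P) ((constant_on f B)%:R * block_weight B) =
  (dinjectiveb f S)%:R.
Proof.
have [k] := ubnP #|S|; elim: k S => // k IH S; rewrite ltnS => leSk.
have step x (xS : x \in S) := @sum_partition_pblock int T
   (fun B => (constant_on f B)%:R * block_weight B) S x xS.
have {}step x : x \in S ->
  \sum_(P | partition P S)
     \prod_(B in P) ((constant_on f B)%:R * block_weight B) =
  \sum_(B : {set T} | (x \in B) && (B \subset S))
   (constant_on f B)%:R * block_weight B * (dinjectiveb f (S :\: B))%:R.
  move=> xS; rewrite (step x xS); apply: eq_bigr => B /andP[xB BS].
  rewrite IH //; apply: leq_trans leSk; apply: proper_card.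
  by rewrite properEneq subsetDl andbT; apply: contraTneq xS => <-; rewrite inE xB.
have [/dinjectiveP injf | /dinjectivePn[x xS [y /andP[/= yx yS] fxy]]] :=
  boolP (dinjectiveb f S).
  have [-> | [x xS]] := set_0Vmem S.
    rewrite (big_pred1 set0) ?big_set0 // => P; exact: partition_set0.
  (* When [f] is injective on [S], only the singleton block of [x] is constant. *)
  rewrite (step x xS) (bigD1 [set x]) /=; last by rewrite set11 sub1set.
  rewrite big1 ?addr0 => [|B /andP[/andP[xB /subsetP BS] Bx]]; last first.
    case: constant_onP => [eqf|_]; last by rewrite !mul0r.
    case/eqP: Bx; apply/setP => z; rewrite inE; apply/idP/eqP => [zB | -> //].
    by apply: injf; [apply: BS | | apply: eqf].
  have -> : constant_on f [set x].
    by apply/constant_onP => i j /set1P-> /set1P->.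
  have -> : dinjectiveb f (S :\ x).
    by apply/dinjectiveP => i j /setD1P[_ iS] /setD1P[_ jS]; apply: injf.
  by rewrite /block_weight cards1.
rewrite (step x xS).
(* The collision [f x = f y] makes the fibre [C] of [x] have at least two points. *)
pose C := [set z in S | f z == f x].
have xC : x \in C by rewrite inE xS eqxx.
have yC : y \in C by rewrite inE yS fxy eqxx.
have CS : C \subset S by apply/subsetP => z; rewrite inE => /andP[].
have subC (B : {set T}) : x \in B -> B \subset S -> constant_on f B -> B \subset C.
  move=> xB /subsetP BS /constant_onP eqf.
  by apply/subsetP => z zB; rewrite inE BS //= (eqf z x).
have constC (B : {set T}) : B \subset C -> constant_on f B.
  move=> /subsetP BC; apply/constant_onP => i j /BC + /BC.
  by rewrite !inE => /andP[_ /eqP->] /andP[_ /eqP->].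
(* A block [B] contributing to the sum lies in [C], so a collision outside [C] is also one outside
   [B] and kills every term. *)
have [/dinjectiveP injSC | ninjSC] := boolP (dinjectiveb f (S :\: C)); last first.
  rewrite big1 // => B /andP[xB BS].
  have [eqf | _] := boolP (constant_on f B); last by rewrite !mul0r.
  suff /negPf-> : ~~ dinjectiveb f (S :\: B) by rewrite mulr0.
  apply: contra ninjSC => /dinjectiveP inj; apply/dinjectiveP.
  by apply: sub_in2 inj; apply/subsetP; rewrite setDS // subC.
rewrite (bigD1 C) /=; last by rewrite xC CS.
set rest := (X in _ + X).
have -> : rest = \sum_(z in C :\ x) block_weight (C :\ z).
  transitivity (\sum_(z in C :\ x) ((constant_on f (C :\ z))%:R *
      block_weight (C :\ z) * (dinjectiveb f (S :\: (C :\ z)))%:R)); last first.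
    apply: eq_bigr => z /setD1P[zx zC]; rewrite constC ?subsetDl // mul1r.
    have -> : dinjectiveb f (S :\: (C :\ z)); last by rewrite mulr1.
    (* The only point of [C] left after removing [C :\ z] is [z], so a collision with [z] would put
       another point in [C]. *)
    apply/dinjectiveP => i j; rewrite !in_setD !in_set1 !negb_and !negbK.
    have [-> | _] := eqVneq i z; have [-> | _] := eqVneq j z => //=.
    - move=> _ /andP[jC jS] fij; case/negP: jC.
      by move: zC; rewrite !inE jS fij => /andP[].
    - move=> /andP[iC iS] _ fij; case/negP: iC.
      by move: zC; rewrite !inE iS fij => /andP[].
    by move=> iSC jSC; apply: injSC; rewrite inE.
  have injD1 : {in C :\ x &, injective (fun z => C :\ z)}.
    move=> i j /setD1P[_ iC] _ /setP/(_ i); rewrite !inE eqxx /=.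
    by move: iC; rewrite inE => ->; rewrite andbT => /esym/negbFE/eqP.
  rewrite -(big_imset (fun B => (constant_on f B)%:R *
      block_weight B * (dinjectiveb f (S :\: B))%:R) injD1) /=.
  rewrite /rest [LHS]big_mkcond [RHS]big_mkcond /=; apply: eq_bigr => B _.
  case: imsetP => [[z /setD1P[zx zC] ->] | nim].
    have xCz : x \in C :\ z by apply/setD1P; rewrite eq_sym.
    have Cz : C :\ z != C by apply: contraTneq zC => <-; rewrite setD11.
    by rewrite xCz (subset_trans (subsetDl _ _) CS) Cz.
  case: ifP => // /andP[/andP[xB BS] BC].
  have [eqf | _] := boolP (constant_on f B); last by rewrite !mul0r.
  have subBC := subC B xB BS eqf.
  case: dinjectiveP => [inj | _]; last by rewrite mulr0.
  (* All points of [C] outside [B] share one value of [f], so injectivity off [B] leaves exactly one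
     such point [z], and then [B] is [C :\ z]. *)
  have /properP[_ [z zC zB]] : B \proper C by rewrite properEneq BC.
  case: nim; exists z; first by rewrite inE zC andbT inE; apply: contraNneq zB => ->.
  apply/eqP; rewrite eqEsubset subsetD1 subBC zB /=.
  apply/subsetP => t /setD1P[tz tC]; apply: contraNT tz => tB; apply/eqP.
  move: zC tC; rewrite !inE => /andP[zS /eqP fz] /andP[tS /eqP ft].
  by apply: inj; rewrite ?inE ?tB ?zB // ft fz.
have -> : dinjectiveb f (S :\: C) by apply/dinjectiveP.
rewrite constC // mul1r mulr1.
have card1 z : z \in C -> #|C| = #|C :\ z|.+1 by move=> zC; rewrite (cardsD1 z) zC.
have [c cE] : exists c, #|C| = c.+2.
  exists #|C :\ x :\ y|; rewrite (card1 x xC) (cardsD1 y (C :\ x)).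
  by rewrite !inE yx yS fxy eqxx.
have cardD1 z : z \in C -> #|C :\ z| = c.+1.
  by move=> zC; apply: succn_inj; rewrite -(card1 z zC).
(* The [c.+1] equal terms of weight [(-1) ^+ c * c!] cancel the term of [C], which is
   [(-1) ^+ c.+1 * (c.+1)!]. *)
rewrite (eq_bigr (fun=> (-1) ^+ c * (c`!)%:Z)) => [|z /setD1P[_ zC]]; last first.
  by rewrite /block_weight cardD1.
rewrite sumr_const cardD1 // /block_weight cE /= factS PoszM exprS mulN1r.
by rewrite mulNr mulrCA -[X in _ + X]mulr_natl (natz c.+1) addNr.
Qed.

(** A block is nonempty and has at most [n] points, so its size is [i.+1] for exactly one
    [i < n]. *)
Lemma big_partition_card (R : Type) (idx : R) (op : Monoid.com_law idx)
    (T : finType) (n : nat) (P : {set {set T}}) (S : {set T})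
    (F : {set T} -> R) : partition P S -> (#|S| <= n)%N ->
  \big[op/idx]_(B in P) F B =
  \big[op/idx]_(i < n) \big[op/idx]_(B in P | #|B| == i.+1) F B.
Proof.
move=> partP leSn.
rewrite (exchange_big_dep (mem P)) /= => [|i B _ /andP[] //].
apply: eq_bigr => B BP.
have B_gt0 : (0 < #|B|)%N by rewrite card_gt0 (partition_neq0 partP).
have ltBn : (#|B|.-1 < n)%N.
  rewrite prednK // (leq_trans _ leSn) // subset_leq_card //.
  by rewrite -(cover_partition partP); apply: (bigcup_max B).
rewrite (big_pred1 (Ordinal ltBn)) // => i.
by rewrite BP /= -val_eqE /= -(prednK B_gt0) eqSS eq_sym.
Qed.

(** Every partition has exactly one type, and counting points by block size shows that this type
    solves the defining equation. *)
Lemma sum_partition_types (R : nmodType) (n : nat) (F : {set {set 'I_n}} -> R) :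
  \sum_(a in partition_types n)
    \sum_(P in partitions_of_type (fun i : 'I_n => tnth a i : nat)) F P =
  \sum_(P | partition P [set: 'I_n]) F P.
Proof.
pose blocks (P : {set {set 'I_n}}) (i : 'I_n) := #|[set B in P | #|B| == i.+1]|.
have sum_blocks P : partition P [set: 'I_n] ->
    (\sum_(i < n) i.+1 * blocks P i)%N = n.
  move=> partP; have /esym := card_partition partP.
  rewrite cardsT card_ord (@big_partition_card _ _ _ _ n _ _ _ partP); last first.
    by rewrite cardsT card_ord.
  move=> sumP; rewrite -[RHS]sumP; apply: eq_bigr => i _.
  rewrite mulnC -sum_nat_const; apply: eq_big => [B | B]; first by rewrite inE.
  by rewrite inE => /andP[_ /eqP].
(* This bound ensures that [inord] below keeps the true block count. *)
have blocks_lt P i : partition P [set: 'I_n] -> (blocks P i < n.+1)%N.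
  move=> partP; rewrite ltnS -[leqRHS](sum_blocks P partP) (bigD1 i) //=.
  by rewrite (leq_trans _ (leq_addr _ _)) // leq_pmull.
pose type P := [tuple inord (blocks P i) : 'I_n.+1 | i < n].
have typeE P i : partition P [set: 'I_n] -> tnth (type P) i = blocks P i :> nat.
  by move=> partP; rewrite tnth_mktuple inordK // blocks_lt.
rewrite [RHS](partition_big type (mem (partition_types n))) /= => [|P partP].
  apply: eq_bigr => a _; apply: eq_bigl => P; rewrite inE.
  have [partP | //] := boolP (partition P _).
  apply/forallP/eqP => [typeP | <- i]; last by rewrite typeE.
  by apply: eq_from_tnth => i; apply: val_inj; rewrite /= typeE //; apply/eqP/typeP.
rewrite inE -[eqbRHS](sum_blocks P partP); apply/eqP.
by apply: eq_bigr => i _; rewrite typeE.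
Qed.

(** Presents the relation as equality of values of a map, so that its classes are fibres. *)
Lemma vertex_equivE (m n : nat) (H : hypergraph m n) (u v : 'I_n) :
  vertex_equiv H u v =
    ([set e | is_edge H e & u \in e] == [set e | is_edge H e & v \in e]).
Proof.
apply/'forall_implyP/eqP => [uv | /setP uv e He].
  apply/setP => e; rewrite !inE; have [He | //] := boolP (is_edge H e).
  by rewrite (eqP (uv e He)).
by have := uv e; rewrite !inE He /= => ->.
Qed.

Lemma sum_compatible_block_weight (m n : nat) (H : hypergraph m n) :
  \sum_(P | partition P [set: 'I_n])
     (compatible H P)%:R * \prod_(B in P) block_weight B =
  (T0_hypergraph H)%:R.
Proof.
pose f (v : 'I_n) := [set e | is_edge H e & v \in e].
transitivity ((dinjectiveb f [set: 'I_n])%:R : int); last first.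
  congr (nat_of_bool _)%:R.
  apply/dinjectiveP/'forall_forallP => [injf u v | T0 u v _ _ fuv].
    rewrite vertex_equivE; apply/implyP; apply: contraNN => /eqP fuv.
    by apply/eqP; apply: injf.
  apply/eqP/negPn/negP => uv; have := T0 u v.
  by rewrite uv vertex_equivE -/(f u) -/(f v) fuv eqxx.
rewrite -sum_partition_constant_on; apply: eq_bigr => P _.
rewrite [RHS]big_split /=; congr (_ * _).
have -> : compatible H P = [forall B in P, constant_on f B].
  apply: eq_forallb_in => B _; apply: eq_forallb_in => i _.
  by apply: eq_forallb_in => j _; rewrite vertex_equivE.
(* The product of the indicators over the blocks is the indicator that all blocks are constant. *)
have [/forall_inP constP | /forall_inPn[B BP nconstB]] := boolP [forall B in P, constant_on f B].
  by rewrite big1 // => B /constP->.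
by rewrite (bigD1 B) //= (negPf nconstB) mul0r.
Qed.

Theorem theorem3p1 (p : hypergraph_property) (m n : nat) (n_gt0 : (0 < n)%N) :
  (alpha_star p m n)%:Z =
  \sum_(a in partition_types n)
    \sum_(P in partitions_of_type (fun i : 'I_n => tnth a i : nat))
      (alpha_part p m P)%:Z *
        \prod_(i < n) ((-1) ^+ i * (i`!)%:Z) ^+ tnth a i.
Proof.
(* Counts become sums of indicators over hypergraphs, so that the sums over hypergraphs and
   partitions can be exchanged. *)
have cardE (q : pred (hypergraph m n)) :
    #|[set H | p m n H & q H]|%:Z = \sum_(H | p m n H) (q H)%:R.
  rewrite -natz -sum1_card natr_sum big_mkcond [RHS]big_mkcond.
  by apply: eq_bigr => H _; rewrite inE; case: (p m n H); case: (q H).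
transitivity (\sum_(P | partition P [set: 'I_n])
    (alpha_part p m P)%:Z * \prod_(B in P) block_weight B).
  rewrite /alpha_star cardE.
  under eq_bigr do rewrite -sum_compatible_block_weight.
  rewrite exchange_big /=; apply: eq_bigr => P _.
  by rewrite /alpha_part cardE big_distrl.
rewrite -sum_partition_types; apply: eq_bigr => a _; apply: eq_bigr => P.
rewrite inE => /andP[partP /forallP typeP]; congr (_ * _).
rewrite (@big_partition_card _ _ _ _ n _ _ _ partP) ?cardsT ?card_ord //.
(* The exponent is the number of blocks of size [i.+1], each of weight [(-1) ^+ i * i!]. *)
apply: eq_bigr => i _; rewrite -(eqP (typeP i)) -prodr_const.
apply: eq_big => [B | B /andP[_ /eqP cardB]]; first by rewrite inE.
by rewrite /block_weight cardB.
Qed.
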